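(* Let $(X,\rho,\mathcal{S})$ be an unbounded complete hyperbolic space, let $\theta\in X$, $s\geq1$, and let $\mathcal{M}$ be the set of all nonexpansive self-mappings of $X$, equipped with the metric $d_{\theta,s}$. Let $\psi_s\colon(0,\infty)\to(0,\infty)$, $\psi_s(t)=t^{1/s}$. There exists a set $\mathcal{F}\subset\mathcal{M}$ such that $\mathcal{M}\setminus\mathcal{F}$ is $\psi_s$-porous in $(\mathcal{M},d_{\theta,s})$ and every $f\in\mathcal{F}$ has the following property: there is an $M_f>0$ such that $f(\bar{B}(\theta,M_f))\subset\bar{B}(\theta,M_f)$.
   Context: Hyperbolic spaces. A geodesic metric space is a metric space $(X,\rho)$ such that for all $x,y\in X$ there is an isometric embedding $c\colon[0,\rho(x,y)]\to X$ with $c(0)=x$, $c(\rho(x,y))=y$; the image of such a $c$ is a metric segment connecting $x$ and $y$. A hyperbolic space is a triple $(X,\rho,\mathcal{S})$ where $(X,\rho)$ is a geodesic metric space and $\mathcal{S}$ is a family of metric segments such that: (1) for each pair $x,y\in X$, $\mathcal{S}$ contains a unique metric segment connecting $x$ and $y$, denoted $[x,y]$; (2) for all $x,y\in X$ and $z,w\in[x,y]$ we have $[z,w]\subset[x,y]$; (3) $\rho((1-\lambda)x\oplus\lambda y,(1-\lambda)x\oplus\lambda z)\leq\lambda\rho(y,z)$ for all $x,y,z\in X$ and $\lambda\in[0,1]$, where $(1-\lambda)x\oplus\lambda y$ denotes the unique point of $[x,y]$ at distance $\lambda\rho(x,y)$ from $x$ and $(1-\lambda)\rho(x,y)$ from $y$.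 We write $\bar{B}(z,r)=\{x\in X\colon\rho(x,z)\leq r\}$. Nonexpansive mappings. A mapping $f\colon X\to X$ is nonexpansive if $\rho(f(x),f(y))\leq\rho(x,y)$ for all $x,y\in X$. Metric. For $f,g\in\mathcal{M}$ put $d_{\theta,s}(f,g)=\sup_{x\in X}\frac{\rho(f(x),g(x))}{1+\rho(x,\theta)^s}$. Porosity. Let $(M,d)$ be a metric space, $A\subset M$, $x\in A$, $\eta\in(0,\infty]$ and $\varphi\colon(0,\eta)\to(0,\infty)$ increasing. Put $\gamma(x,r,A)=\sup\{s>0\colon\exists x'\in M\text{ with }B_M(x',s)\subset B_M(x,r)\setminus A\}$, where $B_M$ denotes open balls and $\sup\emptyset=-\infty$ (so $A$ is not porous at $x$ if $\gamma(x,r,A)=-\infty$ for arbitrarily small $r$). $A$ is $\varphi$-porous at $x$ if $\liminf_{r\to0}\varphi(\gamma(x,r,A))/r>0$, and $\varphi$-porous if it is $\varphi$-porous at each of its points. *)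

(* Defs.v *)
From HB Require Import structures.
From mathcomp Require Import all_boot all_order all_algebra.
From mathcomp Require Import all_classical all_reals all_analysis.
Import Order.TTheory GRing.Theory Num.Theory.
Import numFieldTopology.Exports numFieldNormedType.Exports.

Set Implicit Arguments.
Unset Strict Implicit.
Unset Printing Implicit Defensive.

Local Open Scope classical_set_scope.
Local Open Scope ring_scope.

Section hyperbolic.
Context {R : realType} {X : metricType R}.
Implicit Types (x y z : X) (A B : set X) (S : set (set X)).

(* The values of c outside [0, mdist x y] are irrelevant. *)
Definition geodesic_path x y (c : R -> X) : Prop :=
  [/\ {in `[0, mdist x y] &, forall t u, mdist (c t) (c u) = `|t - u|},
      c 0 = x & c (mdist x y) = y].

Definition metric_segment x y A : Prop :=
  exists2 c, geodesic_path x y c & A = c @` `[0, mdist x y].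

Definition is_seg S x y A : Prop := S A /\ metric_segment x y A.

(* is_conv S lam x y p: p is the point (1 - lam) x (+) lam y of [x, y]. *)
Definition is_conv S (lam : R) x y (p : X) : Prop :=
  exists2 A, is_seg S x y A &
    [/\ A p, mdist x p = lam * mdist x y & mdist p y = (1 - lam) * mdist x y].

(* [x, y] and (1 - lam) x (+) lam y are rendered by the relations is_seg and
   is_conv; the former is functional by hyp_uniq, and then so is the latter,
   because segments are isometric images of intervals. *)
Record hyperbolic S : Prop := Hyperbolic {
  hyp_geodesic : forall x y, exists c, geodesic_path x y c ;
  hyp_segments : forall A, S A -> exists x y, metric_segment x y A ;
  hyp_uniq : forall x y, exists! A, is_seg S x y A ;
  hyp_sub : forall x y z w A B, is_seg S x y A -> A z -> A w ->
    is_seg S z w B -> B `<=` A ;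
  hyp_conv : forall x y z lam p q, 0 <= lam <= 1 ->
    is_conv S lam x y p -> is_conv S lam x z q ->
    mdist p q <= lam * mdist y z
}.

Definition unbounded_space : Prop := ~ exists r : R, forall x y, mdist x y <= r.

(* The axiom of completeType, without its requirement that X be pointed. *)
Definition complete_space : Prop :=
  forall F : set_system X, ProperFilter F -> cauchy F ->
    exists l : X, F --> l.

(* The library's closed_ball is the closure of the open ball. *)
Definition cball z (r : R) : set X := [set x | mdist x z <= r].

End hyperbolic.
Arguments unbounded_space {R} X.
Arguments complete_space {R} X.

Section nonexpansive.
Context {R : realType}.

Definition nonexpansive (X : metricType R) (f : X -> X) : Prop :=
  forall x y, mdist (f x) (f y) <= mdist x y.

Record nonexp (X : metricType R) : Type := Nonexp {
  nonexp_fun :> X -> X ;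
  nonexpP : nonexpansive nonexp_fun
}.

(* The set of nonexpansive self-mappings, tagged with the parameters of the
   metric it carries. The hypothesis 1 <= s makes the supremum finite. *)
Definition nonexp_space (X : metricType R) (theta : X) (s : R) of 1 <= s :=
  nonexp X.

Definition dist_ratio (X : metricType R) (theta : X) (s : R)
    (f g : nonexp X) (x : X) : R :=
  mdist (f x) (g x) / (1 + mdist x theta `^ s).

Definition nonexp_dist (X : metricType R) (theta : X) (s : R)
    (f g : nonexp X) : R :=
  sup (range (dist_ratio theta s f g)).

End nonexpansive.

Section nonexp_metric.
Context {R : realType} {X : metricType R} (theta : X) (s : R) (s1 : 1 <= s).

Local Notation M := (nonexp_space theta s1).
Local Notation dist := (@nonexp_dist R X theta s).
Local Notation ratio := (@dist_ratio R X theta s).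
Implicit Types f g h : nonexp X.

Let w_gt0 (x : X) : 0 < 1 + mdist x theta `^ s.
Proof. by rewrite ltr_pwDl// powR_ge0. Qed.

Let ratio_ge0 f g x : 0 <= ratio f g x.
Proof. by rewrite divr_ge0 ?mdist_ge0// ltW. Qed.

Let le_w (x : X) : mdist x theta <= 1 + mdist x theta `^ s.
Proof.
have [t1|/ltW t1] := leP (mdist x theta) 1.
  by rewrite (le_trans t1)// lerDl powR_ge0.
rewrite -[leLHS]powRr1 ?mdist_ge0//.
by rewrite (le_trans (ler_powR t1 s1))// lerDr.
Qed.

Lemma has_sup_dist_ratio f g : has_sup (range (ratio f g)).
Proof.
split; first by exists (ratio f g theta); exists theta.
exists (mdist (f theta) (g theta) + 2) => _ [x _ <-].
rewrite /dist_ratio ler_pdivrMr//.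
have h1 : mdist (f x) (f theta) <= 1 + mdist x theta `^ s.
  exact: le_trans (nonexpP f x theta) (le_w x).
have h2 : mdist (g theta) (g x) <= 1 + mdist x theta `^ s.
  by rewrite metric_sym; exact: le_trans (nonexpP g x theta) (le_w x).
rewrite (le_trans (metric_triangle _ (f theta) _))//.
rewrite (le_trans (lerD (lexx _) (metric_triangle _ (g theta) _)))//.
rewrite mulrDl mulr_natl mulr2n addrCA lerD//; last exact: lerD.
by rewrite ler_peMr ?mdist_ge0// lerDl powR_ge0.
Qed.

Lemma dist_ratio_le f g x : ratio f g x <= dist f g.
Proof. by apply: ub_le_sup; [case: (has_sup_dist_ratio f g)|exists x]. Qed.

Lemma nonexp_dist_le f g (a : R) :
  (forall x, ratio f g x <= a) -> dist f g <= a.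
Proof.
move=> fga; apply: ge_sup; last by move=> _ [x _ <-].
by case: (has_sup_dist_ratio f g).
Qed.

Let dist_ge0 f g : 0 <= dist f g.
Proof. exact: le_trans (ratio_ge0 f g theta) (dist_ratio_le _ _ _). Qed.

Let distxx f : dist f f = 0.
Proof.
apply/eqP; rewrite eq_le dist_ge0 andbT; apply: nonexp_dist_le => x.
by rewrite /dist_ratio mdistxx mul0r.
Qed.

Let dist_positivity f g : dist f g = 0 -> f = g.
Proof.
move=> fg0; have fg : nonexp_fun f = g.
  apply/funext => x; apply: mdist_positivity; apply/eqP.
  have /eqP : ratio f g x = 0.
    by apply/eqP; rewrite eq_le ratio_ge0 andbT -fg0 dist_ratio_le.
  by rewrite mulf_eq0 invr_eq0 (gt_eqF (w_gt0 x)) orbF.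
case: f g fg {fg0} => [f fP] [g gP] /= fg; subst g.
by congr Nonexp; exact: Prop_irrelevance.
Qed.

Let dist_sym f g : dist f g = dist g f.
Proof.
rewrite /nonexp_dist (_ : ratio f g = ratio g f)//.
by apply/funext => x; rewrite /dist_ratio metric_sym.
Qed.

Let dist_triangle g f h : dist f h <= dist f g + dist g h.
Proof.
apply: nonexp_dist_le => x.
rewrite (le_trans _ (lerD (dist_ratio_le f g x) (dist_ratio_le g h x)))//.
by rewrite -mulrDl ler_pM2r ?invr_gt0// metric_triangle.
Qed.

HB.instance Definition _ := gen_eqMixin M.
HB.instance Definition _ := gen_choiceMixin M.
HB.instance Definition _ := @isMetric.Build R M dist
  distxx dist_positivity dist_sym dist_triangle.

Lemma mdist_nonexpE (f g : M) : mdist f g = dist f g.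
Proof. by []. Qed.

End nonexp_metric.

Section porosity.
Context {R : realType}.

Record gauge : Type := Gauge {
  gauge_eta : \bar R ;
  gauge_fun :> R -> R ;
  gauge_eta_gt0 : (0 < gauge_eta)%E ;
  gauge_gt0 : forall t, 0 < t -> (t%:E < gauge_eta)%E -> 0 < gauge_fun t ;
  gauge_incr : forall t u, 0 < t -> t < u -> (u%:E < gauge_eta)%E ->
    gauge_fun t < gauge_fun u
}.

(* The value at -oo encodes the convention that a set is not porous at x if
   gamma x r A = -oo for arbitrarily small r. If x is in A and r < eta, then
   gamma x r A is either -oo or in ]0, r], so no other value of phi outside
   ]0, eta[ is ever relevant. *)
Definition gauge_ext (phi : gauge) (e : \bar R) : \bar R :=
  match e with t%:E => (phi t)%:E | +oo => +oo | -oo => -oo end%E.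

Definition gamma (M : metricType R) (x : M) (r : R) (A : set M) : \bar R :=
  ereal_sup [set s%:E | s in
    [set s : R | 0 < s /\ exists x' : M, ball x' s `<=` ball x r `\` A]].

Definition porous_at (M : metricType R) (phi : gauge) (A : set M) (x : M) :
    Prop :=
  (0 < limf_einf (fun r : R => gauge_ext phi (gamma x r A) * r^-1%:E) 0^'+)%E.

Definition porous (M : metricType R) (phi : gauge) (A : set M) : Prop :=
  forall x, A x -> porous_at phi A x.

Let psi_gt0 (s t : R) : 0 < t -> (t%:E < +oo)%E -> 0 < t `^ s^-1.
Proof. by move=> t0 _; rewrite powR_gt0. Qed.

Let psi_incr (s : R) : 1 <= s -> forall t u, 0 < t -> t < u ->
  (u%:E < +oo)%E -> t `^ s^-1 < u `^ s^-1.
Proof.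
move=> s1 t u t0 tu _; rewrite gt0_ltr_powR//.
- by rewrite invr_gt0 (lt_le_trans ltr01).
- by rewrite nnegrE ltW.
- by rewrite nnegrE ltW// (lt_trans t0).
Qed.

Definition psi (s : R) (s1 : 1 <= s) : gauge :=
  @Gauge +oo%E (fun t => t `^ s^-1) (ltry 0) (@psi_gt0 s) (psi_incr s1).

End porosity.
Arguments gauge : clear implicits.

(* Main.v *)
(** Moving every value of a nonexpansive map f a proportion gamma towards theta
gives a (1 - gamma)-Lipschitz map f' at distance at most gamma * K from f, where
K = 1 + rho (f theta) theta. On the ball of radius m = 2 K / gamma the values of
f' leave a margin of order K >= 1 inside that ball, while an error sigma in the
metric d_{theta,s} displaces points there by at most sigma * (1 + m^s). Hence
every map within sigma ~ m^{-s} ~ gamma^s of f' maps this ball into itself. With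
gamma ~ r, the set of such maps contains a ball of radius ~ r^s inside
the ball of radius r around f. *)
Require Import Defs.
From mathcomp Require Import all_boot all_order all_algebra.
From mathcomp Require Import all_classical all_reals all_analysis.
From mathcomp Require Import ring lra.
Import Order.TTheory GRing.Theory Num.Theory.
Import numFieldTopology.Exports numFieldNormedType.Exports.
Local Open Scope classical_set_scope.
Local Open Scope ring_scope.

Lemma limf_einf_ge {R : realType} {T : choiceType} {X : filteredType T}
    (F : set_system X) (f : X -> \bar R) (V : set X) (a : \bar R) :
  F V -> (forall x, V x -> (a <= f x)%E) -> (a <= limf_einf f F)%E.
Proof.
move=> FV af; rewrite limf_einfE.
apply: (@le_trans _ _ (ereal_inf (f @` V))).
  by apply: le_ereal_inf_tmp => _ [x Vx <-]; exact: af.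
by apply: ereal_sup_ubound; exists V.
Qed.

(** Since [psi s1] inverts [t => t ^ s], it sends the radius [(c * r) ^ s] to [c * r], so the
    quotient in the lower limit is at least [c] for all small [r]. *)
Lemma psi_porous_at {R : realType} {M : metricType R} {s : R} (s1 : 1 <= s)
    (A : set M) (x : M) (c : R) : 0 < c ->
  (\forall r \near (0 : R)^'+,
    exists y : M, ball y ((c * r) `^ s) `<=` ball x r `\` A) ->
  porous_at (psi s1) A x.
Proof.
move=> c0 nearA; have s0 : 0 < s := lt_le_trans ltr01 s1.
apply: (@lt_le_trans _ _ c%:E); first by rewrite lte_fin.
have VP : (0 : R)^'+ ([set r : R | exists y : M,
    ball y ((c * r) `^ s) `<=` ball x r `\` A] `&` [set r | 0 < r]).
  by apply: filterI; [exact: nearA|exact: nbhs_right_gt].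
apply: (limf_einf_ge _ _ _ _ VP) => r [[y yA] /= r0].
have cr0 : 0 < c * r by rewrite mulr_gt0.
have : (((c * r) `^ s)%:E <= gamma x r A)%E.
  apply: ereal_sup_ubound => /=; exists ((c * r) `^ s) => //.
  by split; [rewrite powR_gt0|exists y].
(* The lower bound just obtained excludes [-oo], and at [+oo] the quotient is [+oo]. *)
case: gamma => [t| |]//=; last first.
  by move=> _; rewrite gt0_mulye ?leey// lte_fin invr_gt0.
rewrite lee_fin => le_t; rewrite -EFinM lee_fin ler_pdivlMr//.
rewrite [leLHS](_ : _ = ((c * r) `^ s) `^ s^-1).
  apply: ge0_ler_powR; rewrite ?invr_ge0 ?nnegrE ?(ltW s0) ?powR_ge0//.
  exact: le_trans (powR_ge0 _ _) le_t.
by rewrite -powRrM divff ?gt_eqF// powRr1 ?ltW.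
Qed.

Section hyperbolic_space.
Context {R : realType} {X : metricType R} {S : set (set X)}.
Hypothesis hypX : hyperbolic S.

Lemma is_conv_exists (l : R) (x y : X) : 0 <= l <= 1 ->
  exists p, is_conv S l x y p.
Proof.
move=> /andP[l0 l1]; have [A [xyA _]] := hyp_uniq hypX x y.
have [_ [c [cP c0 c1] AE]] := xyA.
have d0 : 0 <= mdist x y := mdist_ge0 x y.
have dI : l * mdist x y \in `[0, mdist x y].
  by rewrite in_itv/= mulr_ge0// ler_piMl.
have I0 : 0 \in `[0, mdist x y] by rewrite in_itv/= lexx.
have I1 : mdist x y \in `[0, mdist x y] by rewrite in_itv/= lexx d0.
exists (c (l * mdist x y)); exists A => //; split.
- by rewrite AE; exists (l * mdist x y).
- by rewrite -[X in mdist X _]c0 cP// sub0r normrN ger0_norm ?mulr_ge0.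
- rewrite -[X in mdist _ X]c1 cP// distrC mulrBl mul1r ger0_norm//.
  by rewrite subr_ge0 ler_piMl.
Qed.

(** Choose [g x] on the segment from [theta] to [f x]. All these segments start at [theta], so
    [hyp_conv] makes [g] even [l]-Lipschitz. *)
Lemma nonexp_contract (theta : X) (f : nonexp X) (l : R) : 0 <= l <= 1 ->
  exists g : nonexp X, forall x,
    mdist theta (g x) = l * mdist theta (f x) /\
    mdist (g x) (f x) = (1 - l) * mdist theta (f x).
Proof.
move=> l01; have /andP[l0 l1] := l01.
have [g gP] := choice (fun x => is_conv_exists l theta (f x) l01).
have gne : nonexpansive g.
  move=> x y; apply: (le_trans (hyp_conv hypX l01 (gP x) (gP y))).
  by rewrite (le_trans _ (nonexpP f x y))// ler_piMl ?mdist_ge0.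
by exists (Nonexp gne) => x; have [A _ []] := gP x.
Qed.

End hyperbolic_space.

Section porosity_of_noninvariance.
Context {R : realType} {X : metricType R} {theta : X} {s : R} {s1 : 1 <= s}.
Implicit Types f g : nonexp_space theta s1.

Let w_gt0 (x : X) : 0 < 1 + mdist x theta `^ s.
Proof. by rewrite ltr_pwDl// powR_ge0. Qed.

Lemma nonexp_growth f (x : X) :
  mdist theta (f x) <= mdist (f theta) theta + mdist x theta.
Proof.
rewrite metric_sym (le_trans (metric_triangle _ (f theta) _))// addrC.
by rewrite lerD2l; exact: nonexpP.
Qed.

Lemma mdist_nonexp_le f g (x : X) (e : R) : mdist f g <= e ->
  mdist (f x) (g x) <= e * (1 + mdist x theta `^ s).
Proof.
rewrite mdist_nonexpE => fge; rewrite -ler_pdivrMr//.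
exact: le_trans (dist_ratio_le theta s1 f g x) fge.
Qed.

(** By [nonexp_growth], [f] grows at most linearly, and as [1 <= s] the weight dominates both [1]
    and the distance to [theta]. *)
Lemma contract_dist_le f g (l : R) : 0 <= l ->
  (forall x, mdist (g x) (f x) = l * mdist theta (f x)) ->
  mdist f g <= l * (1 + mdist (f theta) theta).
Proof.
move=> l0 gf; rewrite mdist_nonexpE; apply: nonexp_dist_le => // x.
rewrite /dist_ratio ler_pdivrMr// metric_sym gf -mulrA ler_wpM2l//.
have d0 : 0 <= mdist x theta := mdist_ge0 _ _.
have le_w : mdist x theta <= 1 + mdist x theta `^ s.
  have [t1|/ltW t1] := leP (mdist x theta) 1.
    by rewrite (le_trans t1)// lerDl powR_ge0.
  by rewrite (le_trans (le1r_powR t1 s1))// lerDr.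
have := nonexp_growth f x; have := mdist_ge0 (f theta) theta.
have := powR_ge0 (mdist x theta) s.
by nra.
Qed.

End porosity_of_noninvariance.

Theorem theorem3p3 (R : realType) (X : metricType R) (S : set (set X))
    (hypX : hyperbolic S) (complX : complete_space X)
    (unbX : unbounded_space X) (theta : X) (s : R) (s1 : 1 <= s) :
  exists F : set (nonexp_space theta s1),
    porous (psi s1) (~` F) /\
    forall f, F f -> exists2 Mf : R, 0 < Mf &
      f @` cball theta Mf `<=` cball theta Mf.
Proof.
exists [set f | exists2 m : R, 0 < m & f @` cball theta m `<=` cball theta m].
split=> // f _; pose K := 1 + mdist (f theta) theta.
have K1 : 1 <= K by rewrite lerDl mdist_ge0.
have K0 : 0 < K by exact: lt_le_trans K1.
have s0 : 0 < s := lt_le_trans ltr01 s1.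
(* With [l] and [m] as below, [m = 4 * K ^ 2 / r]; this [c] gives [c * r = 1 / (2 * m)]. *)
pose c := (8 * K ^+ 2)^-1.
have c0 : 0 < c by rewrite invr_gt0 mulr_gt0// exprn_gt0.
apply: (psi_porous_at _ _ _ c) => //.
near=> r.
have r0 : 0 < r by near: r; exact: nbhs_right_gt.
have r1 : r < 1 by near: r; exact: nbhs_right_lt.
(* Chosen so that [g] lies within [l * K = r / 2] of [f], leaving [r / 2] for the ball around
   [g]. *)
pose l := r / (2 * K).
have lK : l * K = r / 2 by rewrite /l; field; rewrite gt_eqF.
have l0 : 0 < l by rewrite divr_gt0// mulr_gt0.
have l1 : l <= 1 by nra.
pose m := 2 * K / l.
have lm : l * m = 2 * K by rewrite mulrC divfK// gt_eqF.
have m1 : 1 <= m by rewrite ler_pdivlMr//; nra.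
have cr : c * r = (2 * m)^-1 by rewrite /c /m /l; field; rewrite !gt_eqF.
have cr0 : 0 < c * r by rewrite mulr_gt0.
have cr1 : c * r <= 2^-1.
  by rewrite cr lef_pV2 ?posrE//; nra.
have e0 := powR_gt0 s cr0.
have le_e : (c * r) `^ s <= c * r.
  by apply: ge1r_powR => //; rewrite cr0/= (le_trans cr1)//; lra.
(* The product is [(1 / 2) ^ s], at most [1 / 2] because [1 <= s]. *)
have em : (c * r) `^ s * m `^ s <= 2^-1.
  rewrite -powRM ?(ltW cr0) ?(le_trans ler01 m1)//.
  rewrite cr invfM mulfVK ?gt_eqF ?(lt_le_trans ltr01 m1)//.
  by apply: ge1r_powR => //; lra.
have c8 : c * r <= r / 8.
  rewrite /c mulrC ler_pM2l// lef_pV2 ?posrE ?mulr_gt0 ?exprn_gt0//; nra.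
have l01 : 0 <= 1 - l <= 1 by lra.
have [g gP] := nonexp_contract hypX theta f _ l01.
exists g => h; rewrite !ballEmdist/= => gh.
have fg : mdist (f : nonexp_space theta s1) g <= r / 2.
  rewrite -lK; apply: contract_dist_le; first exact: ltW.
  by move=> x; have [_ ->] := gP x; congr (_ * _); lra.
split; first by have := metric_triangle (f : nonexp_space theta s1) g h; lra.
(* Avoiding the complement means that [h] has an invariant ball; its radius is [m]. *)
apply; exists m; first exact: lt_le_trans m1.
move=> _ [x xm <-]; rewrite /cball/= in xm *.
have hx := mdist_nonexp_le g h x _ (ltW gh).
have xs : mdist x theta `^ s <= m `^ s.
  by apply: ge0_ler_powR; rewrite ?nnegrE ?mdist_ge0 ?(ltW s0)//; lra.
have [gx _] := gP x.
have fx := nonexp_growth f x.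
(* Both [(c * r) ^ s] and [(c * r) ^ s * m ^ s] are at most [1 / 2]. *)
have hg : mdist (g x) (h x) <= 1.
  apply: (le_trans hx); rewrite mulrDr mulr1.
  by have := ler_wpM2l (ltW e0) xs; lra.
have gb : (1 - l) * mdist theta (f x) <= (1 - l) * (K - 1 + m).
  by rewrite ler_wpM2l//; rewrite ?/K; lra.
(* The bound is [1 + (1 - l) * (K - 1 + m)], which by [l * m = 2 * K] equals [m - K - l * (K - 1)],
   hence is at most [m]. *)
have := metric_triangle (h x) (g x) theta.
rewrite (metric_sym (h x) (g x)) (metric_sym (g x) theta) gx.
nra.
Unshelve. all: by end_near. Qed.
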